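(* Let $N\geq 2$ be an integer. For all positive semidefinite matrices $A=(a_{jk})_{j,k=0}^{N-1}$ and $B=(b_{jk})_{j,k=0}^{N-1}$ in $\mathbb{C}^{N\times N}$, $$\det (A\diamond B) \geq b_{00}^{N} \det A + a_{00}^{N}\det B,$$ where $A\diamond B$ denotes the Jury product.
   Context: Rows and columns of $N\times N$ matrices are indexed by $0,1,\dots,N-1$. A matrix $A\in\mathbb{C}^{N\times N}$ is positive semidefinite if $z^*Az\geq 0$ for all $z\in\mathbb{C}^N$. The Jury product of $A=(a_{jk})$ and $B=(b_{jk})$ in $\mathbb{C}^{N\times N}$ is the matrix $A\diamond B\in\mathbb{C}^{N\times N}$ with entries $$(A\diamond B)_{jk}:=\sum_{m=0}^{j}\sum_{n=0}^{k}a_{m,n}\,b_{j-m,k-n},\qquad 0\le j,k\le N-1.$$ *)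

(* Defs.v *)
From mathcomp Require Export all_boot all_order all_algebra.
From mathcomp Require Export complex reals.

Set Implicit Arguments.
Unset Strict Implicit.
Unset Printing Implicit Defensive.

Import Order.TTheory GRing.Theory Num.Theory.

Local Open Scope ring_scope.
Local Open Scope sesquilinear_scope.

(* On a numClosedFieldType such as [R[i]] the order is partial: [0 <= w] says
   that w is real and nonnegative. *)
Definition psd (C : numClosedFieldType) (N : nat) (A : 'M[C]_N) : Prop :=
  forall z : 'cV[C]_N, 0 <= (z ^t* *m A *m z) 0 0.

(* The subtraction is truncated: this is the index j - m only when m <= j. *)
Definition ord_subn (N : nat) (j m : 'I_N) : 'I_N :=
  Ordinal (leq_ltn_trans (leq_subr m j) (ltn_ord j)).

Definition jury_mul (C : pzSemiRingType) (N : nat) (A B : 'M[C]_N) : 'M[C]_N :=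
  \matrix_(j < N, k < N)
    \sum_(m < N | (m <= j)%N) \sum_(n < N | (n <= k)%N)
      A m n * B (ord_subn j m) (ord_subn k n).

Definition entry00 (C : Type) (N : nat) (hN : (2 <= N)%N) (A : 'M[C]_N) : C :=
  A (Ordinal (ltnW hN)) (Ordinal (ltnW hN)).

(* Main.v *)
(* Split off the first row and column of each matrix: A = vv^H + A' and
   B = ww^H + B', where A' and B' are positive semidefinite and vanish on row
   and column 0.  The Jury product with vv^H is the congruence by the lower
   triangular Toeplitz matrix of v, of determinant v_0^N.  Hence
   vv^H <> ww^H = pp^H is rank one and
     det (pp^H + vv^H <> B') = det (vv^H <> B) = a_00^N det B,
     det (pp^H + A' <> ww^H) = det (A <> ww^H) = b_00^N det A,
   whereas A <> B = pp^H + vv^H <> B' + A' <> ww^H + A' <> B'.  On positive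
   semidefinite D vanishing on row and column 0, det (pp^H + D) is |p_0|^2
   times the determinant of the lower right block of D, hence superadditive
   in D because det is. *)
Require Import Defs.
From mathcomp Require Import ring.

Import Order.TTheory GRing.Theory Num.Theory.

Local Open Scope ring_scope.
Local Open Scope sesquilinear_scope.

(** * Conjugate transposes and the standard inner product *)

Section ConjugateTranspose.
Local Set Implicit Arguments.
Local Unset Strict Implicit.
Variable C : numClosedFieldType.

Lemma trmxC_mul m n p (X : 'M[C]_(m, n)) (Y : 'M[C]_(n, p)) :
  (X *m Y) ^t* = Y ^t* *m X ^t*.
Proof. by rewrite trmx_mul map_mxM. Qed.

Lemma trmxCD m n (X Y : 'M[C]_(m, n)) : (X + Y) ^t* = X ^t* + Y ^t*.
Proof. by rewrite linearD map_mxD. Qed.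

Lemma trmxC_col m1 m2 n (X : 'M[C]_(m1, n)) (Y : 'M[C]_(m2, n)) :
  (col_mx X Y) ^t* = row_mx (X ^t*) (Y ^t*).
Proof. by rewrite tr_col_mx map_row_mx. Qed.

Lemma trmxC0 m n : (0 : 'M[C]_(m, n)) ^t* = 0.
Proof. by rewrite trmx0 map_mx0. Qed.

Lemma outer_mxE m n (v : 'cV[C]_m) (w : 'cV[C]_n) j k :
  (v *m w ^t*) j k = v j 0 * (w k 0)^*.
Proof. by rewrite mxE big_ord1 !mxE. Qed.

Lemma inner_self_ge0 n (v : 'cV[C]_n) : 0 <= (v ^t* *m v) 0 0.
Proof.
by rewrite mxE sumr_ge0 // => i _; rewrite !mxE mulrC mul_conjC_ge0.
Qed.

Lemma inner_self_eq0 n (v : 'cV[C]_n) : (v ^t* *m v) 0 0 = 0 -> v = 0.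
Proof.
rewrite mxE => /eqP; rewrite psumr_eq0 => [/allP v0|i _]; last first.
  by rewrite !mxE mulrC mul_conjC_ge0.
apply/colP => i; rewrite mxE; apply/eqP.
by have := v0 i (mem_index_enum i); rewrite !mxE mulrC mul_conjC_eq0.
Qed.

Lemma inner_conj n (v w : 'cV[C]_n) :
  ((v ^t* *m w) 0 0)^* = (w ^t* *m v) 0 0.
Proof.
rewrite !mxE rmorph_sum; apply: eq_bigr => i _.
by rewrite !mxE rmorphM /= conjCK mulrC.
Qed.

End ConjugateTranspose.

(** * Positive semidefinite matrices: Schur complements and determinants *)

Section PositiveSemidefinite.
Local Set Implicit Arguments.
Local Unset Strict Implicit.
Variable C : numClosedFieldType.

Lemma psdD n (X Y : 'M[C]_n) : psd X -> psd Y -> psd (X + Y).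
Proof.
by move=> hX hY z; rewrite mulmxDr mulmxDl mxE addr_ge0.
Qed.

Lemma psd0 n : psd (0 : 'M[C]_n).
Proof. by move=> z; rewrite mulmx0 mul0mx mxE. Qed.

Lemma psd_congr m n (K : 'M[C]_(m, n)) (X : 'M[C]_n) :
  psd X -> psd (K *m X *m K ^t*).
Proof.
move=> hX z; have := hX (K ^t* *m z).
by rewrite trmxC_mul trmxCK !mulmxA.
Qed.

Lemma psd_outer n (v : 'cV[C]_n) : psd (v *m v ^t*).
Proof.
move=> z; rewrite mulmxA -mulmxA -[v ^t* *m z]trmxCK trmxC_mul trmxCK.
by rewrite outer_mxE mul_conjC_ge0.
Qed.

Lemma psd_block m n (M : 'M[C]_n) :
  psd M -> psd (block_mx 0 0 0 M : 'M[C]_(m + n)).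
Proof.
move=> /(psd_congr (col_mx (0 : 'M[C]_(m, n)) 1%:M)).
rewrite trmxC_col trmxC0 trmx1 map_mx1 mul_col_mx mul_col_row.
by rewrite !(mulmx1, mul1mx, mul0mx, mulmx0).
Qed.

(* Polarization: the form is real on x + y and on x + i y. *)
Lemma psd_hermitian n (A : 'M[C]_n) : psd A -> A ^t* = A.
Proof.
move=> hA; apply/matrixP => k j; rewrite !mxE.
pose f (x y : 'cV[C]_n) := (x ^t* *m A *m y) 0 0.
have fDl x y z : f (x + y) z = f x z + f y z.
  by rewrite /f trmxCD !mulmxDl mxE.
have fDr x y z : f x (y + z) = f x y + f x z.
  by rewrite /f mulmxDr mxE.
have fZr c x y : f x (c *: y) = c * f x y by rewrite /f -scalemxAr mxE.
have fZl c x y : f (c *: x) y = c^* * f x y.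
  by rewrite /f linearZ map_mxZ -!scalemxAl mxE.
have f_real x : (f x x)^* = f x x by apply/CrealP/ger0_real/hA.
have fconj x y : (f x y)^* = f y x.
  have h1 := f_real (x + y); have h2 := f_real (x + 'i *: y).
  rewrite !(fDl, fDr) !rmorphD /= !f_real in h1.
  rewrite !(fDl, fDr, fZl, fZr) !rmorphD !rmorphM /= in h2.
  rewrite !f_real conjCK conjCi in h2.
  have {}h1 : (f x y)^* + (f y x)^* = f x y + f y x.
    apply: (addrI (f x x + f y y)).
    apply: etrans (etrans h1 _); ring.
  have {}h2 : (f y x)^* - (f x y)^* = f x y - f y x.
    apply: (mulfI (neq0Ci C)).
    apply: (addrI (f x x + - 'i * ('i * f y y))).
    apply: etrans (etrans h2 _); ring.
  apply: (mulfI (_ : 2 != 0)); first by rewrite pnatr_eq0.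
  transitivity (((f x y)^* + (f y x)^*) - ((f y x)^* - (f x y)^*)).
    by ring.
  by rewrite h1 h2; ring.
have fE i l : f (delta_mx i 0) (delta_mx l 0) = A i l.
  by rewrite /f trmx_delta map_delta_mx -rowE -colE !mxE.
by rewrite -!fE fconj.
Qed.

Lemma psd_form_col n a (b : 'cV[C]_n) (M : 'M[C]_n) x (y : 'cV[C]_n) :
  ((col_mx x%:M y) ^t* *m block_mx (a%:M : 'M_1) (b ^t*) b M
    *m col_mx x%:M y) 0 0
  = x^* * a * x + x * ((b ^t* *m y) 0 0)^* + x^* * (b ^t* *m y) 0 0
    + (y ^t* *m M *m y) 0 0.
Proof.
rewrite trmxC_col mul_row_block mul_row_col tr_scalar_mx map_scalar_mx /=.
rewrite inner_conj -scalar_mxM !mulmxDl -scalar_mxM mul_scalar_mx.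
rewrite mul_mx_scalar -scalemxAl !mxE eqxx mulr1n.
by ring.
Qed.

(** One step of a Cholesky factorization. If the corner [a] is positive, [v] is the first column
    divided by [sqrtC a] and [M] is the Schur complement of [a]. If [a = 0], the whole first column
    vanishes and [v = 0] works. *)
Lemma psd_split n (A : 'M[C]_(1 + n)) : psd A ->
  exists v : 'cV[C]_(1 + n), exists2 M : 'M[C]_n,
    psd M & A = v *m v ^t* + block_mx 0 0 0 M.
Proof.
move=> hA; have hH := psd_hermitian hA.
pose a := A 0 0; pose b := dlsubmx A; pose M := drsubmx A.
have Ablk : A = block_mx (a%:M : 'M_1) (b ^t*) b M.
  rewrite -[LHS]submxK; congr block_mx.
    rewrite [LHS]mx11_scalar !mxE; congr (A _ _)%:M; exact: val_inj.
  by rewrite /b -{1}hH; apply/matrixP=> i j; rewrite !mxE.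
have q_ge0 x (y : 'cV[C]_n) : 0 <= x^* * a * x + x * ((b ^t* *m y) 0 0)^*
    + x^* * (b ^t* *m y) 0 0 + (y ^t* *m M *m y) 0 0.
  by have := hA (col_mx (x%:M : 'M_1) y); rewrite {1}Ablk psd_form_col.
have a_ge0 : 0 <= a.
  have := q_ge0 1 0; rewrite !mulmx0 mxE !rmorph1 rmorph0.
  by rewrite !mulr1 mul1r mulr0 !addr0.
have [a0|a_neq0] := eqVneq a 0.
  (* With b != 0, the form at z = (-t, b) would equal -1 for t as below. *)
  have b0 : b = 0.
    apply: inner_self_eq0; set s := _ 0 0.
    apply/eqP/negPn/negP => s_neq0.
    have s_ge0 : 0 <= s by exact: inner_self_ge0.
    pose c := (b ^t* *m M *m b) 0 0.
    have c_ge0 : 0 <= c.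
      by have := q_ge0 0 b; rewrite conjC0 !mul0r !add0r.
    pose t := (c + 1) / (2 * s).
    have tC : t^* = t.
      by apply/CrealP/ger0_real; rewrite divr_ge0 ?addr_ge0 ?mulr_ge0.
    have sC : s^* = s by apply/CrealP/ger0_real.
    have := q_ge0 (- t) b; rewrite -/s -/c a0 sC rmorphN /= tC.
    have -> : - t * 0 * - t + - t * s + - t * s + c = -1.
      by rewrite /t; field.
    by rewrite oppr_ge0 lt_geF ?ltr01.
  exists 0, M.
    by move=> y; have := q_ge0 0 y; rewrite conjC0 !mul0r !add0r.
  rewrite mul0mx add0r {1}Ablk a0 b0 trmxC0; congr block_mx.
  by rewrite -scalemx1 scale0r.
have aC : a^* = a by apply/CrealP/ger0_real.
pose r := sqrtC a.
have rr : r * r = a by rewrite -expr2 sqrtCK.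
have rC : r^* = r by apply/CrealP/ger0_real; rewrite sqrtC_ge0.
have r_neq0 : r != 0 by rewrite sqrtC_eq0.
exists (col_mx r%:M (r^-1 *: b)), (M - a^-1 *: (b *m b ^t*)).
  (* This first coordinate minimizes the form for fixed [y]; the minimum is the form of the Schur
     complement at [y]. *)
  move=> y; have := q_ge0 (- (b ^t* *m y) 0 0 / a) y.
  congr (0 <= _).
  rewrite mulmxBr mulmxBl -scalemxAr -scalemxAl.
  rewrite [RHS]mxE [X in _ = _ + X]mxE [X in _ = _ - X]mxE.
  have -> : (y ^t* *m (b *m b ^t*) *m y) 0 0
      = ((b ^t* *m y) 0 0)^* * (b ^t* *m y) 0 0.
    by rewrite mulmxA -mulmxA inner_conj [LHS]mxE big_ord1.
  rewrite rmorphM rmorphN fmorphV /= aC.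
  by field.
rewrite trmxC_col mul_col_row tr_scalar_mx map_scalar_mx /= rC.
rewrite -scalar_mxM rr linearZ map_mxZ fmorphV /= rC.
rewrite mul_scalar_mx mul_mx_scalar !scalerA mulfV // !scale1r.
rewrite -scalemxAl -scalemxAr scalerA -invfM rr.
by rewrite add_block_mx !addr0 addrC subrK.
Qed.

(** The matrix factors into a block lower and a block upper triangular one, with corners [v 0 0] and
    its conjugate. *)
Lemma det_outerD n (v : 'cV[C]_(1 + n)) (M : 'M[C]_n) :
  \det (v *m v ^t* + block_mx 0 0 0 M) = `|v 0 0| ^+ 2 * \det M.
Proof.
pose x := usubmx v; pose y := dsubmx v.
have -> : v *m v ^t* + block_mx 0 0 0 M =
    block_mx x 0 y 1%:M *m block_mx (x ^t*) (y ^t*) 0 M.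
  rewrite -{1 2}[v]vsubmxK -/x -/y trmxC_col mul_col_row.
  rewrite mulmx_block add_block_mx.
  by rewrite !(mulmx0, mul0mx, mul1mx, addr0).
rewrite det_mulmx det_lblock det_ublock det1 mulr1 mulrA !det_mx11 normCK.
rewrite /x !mxE.
suff -> : lshift n (0 : 'I_1) = 0 by [].
exact: val_inj.
Qed.

Lemma psd_det_ge0 n (A : 'M[C]_n) : psd A -> 0 <= \det A.
Proof.
elim: n A => [A _|n IH A /psd_split[v [M hM ->]]]; first by rewrite det_mx00.
by rewrite det_outerD mulr_ge0 ?exprn_ge0 ?IH.
Qed.

(** Induction on the size, starting with equality for size 1. Size 0 must be excluded, since every
    determinant is 1 there. *)
Lemma psd_detD n (X Y : 'M[C]_n.+1) : psd X -> psd Y ->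
  \det X + \det Y <= \det (X + Y).
Proof.
elim: n X Y => [X Y _ _|n IH X Y].
  by rewrite !det_mx11 mxE.
move=> /(@psd_split n.+1)[v [X' hX' ->]] /(@psd_split n.+1)[w [Y' hY' ->]].
(* vv^H + ww^H = uu^H + (0 (+) S), so all three determinants factor through
   their (0,0) entries, with |u_0|^2 = |v_0|^2 + |w_0|^2. *)
have [u [S hS vwE]] :=
  psd_split (psdD (psd_outer v) (psd_outer w) : psd (_ : 'M_(1 + n.+1))).
have u0 : `|u 0 0| ^+ 2 = `|v 0 0| ^+ 2 + `|w 0 0| ^+ 2.
  have /matrixP/(_ (lshift _ 0) (lshift _ 0)) := vwE.
  have -> : lshift n.+1 (0 : 'I_1) = 0 by exact: val_inj.
  rewrite [LHS]mxE [RHS]mxE !outer_mxE -!normCK => ->.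
  have -> : 0 = lshift n.+1 (0 : 'I_1) by exact: val_inj.
  by rewrite block_mxEul mxE addr0.
have -> : v *m v ^t* + block_mx 0 0 0 X' + (w *m w ^t* + block_mx 0 0 0 Y')
    = u *m u ^t* + block_mx 0 0 0 (X' + Y' + S).
  rewrite addrACA vwE -addrA !add_block_mx !addr0; congr (_ + block_mx _ _ _ _).
  by rewrite addrC.
rewrite !det_outerD u0 mulrDl.
(* The induction hypothesis serves twice: once for [X'] and [Y'], once to add [S], whose nonnegative
   determinant is dropped. *)
have hXY : \det X' + \det Y' <= \det (X' + Y' + S).
  apply: le_trans (IH _ _ (psdD hX' hY') hS).
  by apply: le_trans (IH _ _ hX' hY') _; rewrite lerDl psd_det_ge0.
apply: lerD; rewrite ler_wpM2l ?exprn_ge0 //; apply: le_trans hXY.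
  by rewrite lerDl psd_det_ge0.
by rewrite lerDr psd_det_ge0.
Qed.

Lemma psd_drblock m n (M : 'M[C]_n) :
  psd (block_mx 0 0 0 M : 'M[C]_(m + n)) -> psd M.
Proof.
move=> hM y; have := hM (col_mx 0 y).
by rewrite trmxC_col mul_row_block mul_row_col trmxC0
  !(mul0mx, mulmx0, add0r).
Qed.

Lemma det_outer_superadditive n (p : 'cV[C]_(1 + n.+1)) (X Y : 'M[C]_n.+1) :
  psd X -> psd Y ->
  \det (p *m p ^t* + block_mx 0 0 0 X) + \det (p *m p ^t* + block_mx 0 0 0 Y)
  <= \det (p *m p ^t* + block_mx 0 0 0 (X + Y)).
Proof.
move=> hX hY; rewrite !det_outerD -mulrDr ler_wpM2l ?exprn_ge0 //.
exact: psd_detD.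
Qed.

Lemma sum_drblock m n I (r : seq I) (F : I -> 'M[C]_n) :
  \sum_(i <- r) block_mx (0 : 'M_m) 0 0 (F i) =
  block_mx 0 0 0 (\sum_(i <- r) F i).
Proof.
elim: r => [|i r IH]; first by rewrite !big_nil block_mx0.
by rewrite !big_cons IH add_block_mx !addr0.
Qed.

(** Iterating [psd_split] peels off one rank-one term per row. This reduces positivity of a Jury
    product to the case of a rank-one factor. *)
Lemma psd_sum_outer n (A : 'M[C]_n) : psd A ->
  exists s : seq 'cV[C]_n, A = \sum_(v <- s) v *m v ^t*.
Proof.
elim: n A => [A _|n IH]; first by exists [::]; apply/matrixP => -[].
suff step (A : 'M[C]_(1 + n)) : psd A ->
    exists s : seq 'cV[C]_(1 + n), A = \sum_(v <- s) v *m v ^t* by exact: step.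
move=> /psd_split[v [M /IH[s ->] ->]].
exists (v :: [seq col_mx 0 w | w <- s]).
rewrite big_cons big_map -sum_drblock; congr (_ + _); apply: eq_bigr => w _.
by rewrite trmxC_col mul_col_row trmxC0 !(mul0mx, mulmx0).
Qed.

End PositiveSemidefinite.

(** * The Jury product as truncated multiplication of polynomials *)

Section JuryProduct.
Local Set Implicit Arguments.
Local Unset Strict Implicit.
Variable C : numClosedFieldType.

Lemma jury_mulDr n (A B D : 'M[C]_n) :
  jury_mul A (B + D) = jury_mul A B + jury_mul A D.
Proof.
apply/matrixP => j k; rewrite !mxE -big_split; apply: eq_bigr => m _ /=.
by rewrite -big_split; apply: eq_bigr => p _ /=; rewrite mxE mulrDr.
Qed.

Lemma jury_mul0r n (A : 'M[C]_n) : jury_mul A 0 = 0.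
Proof.
apply/matrixP => j k; rewrite !mxE.
by rewrite big1 // => m _; rewrite big1 // => p _; rewrite mxE mulr0.
Qed.

Lemma ord_subnK n (j m : 'I_n) : (m <= j)%N -> ord_subn j (ord_subn j m) = m.
Proof. by move=> mj; apply: val_inj => /=; rewrite subKn. Qed.

Lemma reindex_ord_subn n (j : 'I_n) (F : 'I_n -> C) :
  \sum_(m < n | (m <= j)%N) F m = \sum_(m < n | (m <= j)%N) F (ord_subn j m).
Proof.
rewrite (reindex_onto (ord_subn j) (ord_subn j)) => [|m mj]; last first.
  exact: ord_subnK.
(* For [m > j] truncation sends [m] to 0 and then to [j], so applying [ord_subn j] twice fixes [m]
   exactly when [m <= j]. *)
apply: eq_bigl => m; rewrite /= leq_subr /=.
apply/eqP/idP => [<-|/ord_subnK//]; exact: leq_subr.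
Qed.

Lemma jury_mulC n (A B : 'M[C]_n) : jury_mul A B = jury_mul B A.
Proof.
apply/matrixP => j k; rewrite !mxE reindex_ord_subn.
apply: eq_bigr => m mj; rewrite reindex_ord_subn.
by apply: eq_bigr => p pk; rewrite !ord_subnK // mulrC.
Qed.

Lemma jury_mulDl n (A B D : 'M[C]_n) :
  jury_mul (A + B) D = jury_mul A D + jury_mul B D.
Proof. by rewrite !(jury_mulC _ D) jury_mulDr. Qed.

(** On coefficient columns this is multiplication by the polynomial with coefficients [v], modulo
    the [n]-th power of the variable. *)
Definition toeplitz n (v : 'cV[C]_n) : 'M[C]_n :=
  \matrix_(j, m) if (m <= j)%N then v (ord_subn j m) 0 else 0.

Lemma det_toeplitz n (v : 'cV[C]_n.+1) : \det (toeplitz v) = v 0 0 ^+ n.+1.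
Proof.
rewrite det_trig; last first.
  by apply/is_trig_mxP => i j ij; rewrite mxE leqNgt ij.
rewrite (eq_bigr (fun=> v 0 0)) ?prodr_const ?card_ord // => i _.
by rewrite mxE leqnn; congr (v _ _); apply: val_inj; rewrite /= subnn.
Qed.

(* The generating polynomial of A in z and the conjugate of w is multiplied by
   v(z) and by the conjugate of v(w). *)
Lemma jury_mul_outer n (A : 'M[C]_n) (v : 'cV[C]_n) :
  jury_mul A (v *m v ^t*) = toeplitz v *m A *m (toeplitz v) ^t*.
Proof.
apply/matrixP => j k; rewrite !mxE.
under [RHS]eq_bigr do rewrite !mxE big_distrl /=.
rewrite [RHS]exchange_big /= [LHS]big_mkcond; apply: eq_bigr => m _ /=.
case: ifP => mj; last first.
  by rewrite big1 // => p _; rewrite !mxE mj !mul0r.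
rewrite big_mkcond; apply: eq_bigr => p _; rewrite !mxE mj.
case: ifP => pk; last by rewrite conjC0 mulr0.
by rewrite big_ord1 !mxE; ring.
Qed.

(** Each rank-one term of [B] contributes a congruence of [A]. *)
Lemma psd_jury_mul n (A B : 'M[C]_n) : psd A -> psd B -> psd (jury_mul A B).
Proof.
move=> hA /psd_sum_outer[s ->]; elim: s => [|v s IH].
  by rewrite big_nil jury_mul0r; exact: psd0.
rewrite big_cons jury_mulDr jury_mul_outer.
by apply: psdD IH; exact: psd_congr.
Qed.

(** In row 0 of a Jury product the row index [m <= 0] of the first factor can only be 0, and
    likewise for columns. *)
Lemma jury_mul_block n (M : 'M[C]_n) (B : 'M[C]_(1 + n)) :
  exists M', jury_mul (block_mx 0 0 0 M) B = block_mx 0 0 0 M'.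
Proof.
set J := jury_mul _ _; exists (drsubmx J).
have blk0 (i j : 'I_(1 + n)) : (i == 0 :> nat) || (j == 0 :> nat) ->
    (block_mx 0 0 0 M : 'M[C]_(1 + n)) i j = 0.
  by case: (split_ordP i) => i' ->; case: (split_ordP j) => j' -> //;
    rewrite (block_mxEul, block_mxEur, block_mxEdl) mxE.
have J0 (i j : 'I_(1 + n)) : (i == 0 :> nat) || (j == 0 :> nat) -> J i j = 0.
  move=> ij0; rewrite mxE big1 // => m mi; rewrite big1 // => p pj.
  rewrite blk0 ?mul0r //; case/orP: ij0 => /eqP e;
    move: mi pj; rewrite e !leqn0.
    by move=> ->.
  by move=> _ ->; rewrite orbT.
rewrite -[LHS]submxK; congr block_mx; apply/matrixP => i j;
  by do 2 rewrite [LHS]mxE; rewrite [RHS]mxE J0 //= ?ord1 ?orbT.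
Qed.

(** With size [n.+2] the lower right blocks have size [n.+1], the range in which [psd_detD]
    holds. *)
Lemma jury_mul_det n (A B : 'M[C]_n.+2) : psd A -> psd B ->
  B 0 0 ^+ n.+2 * \det A + A 0 0 ^+ n.+2 * \det B <= \det (jury_mul A B).
Proof.
move=> /(@psd_split _ n.+1)[v [A' hA' AE]] /(@psd_split _ n.+1)[w [B' hB' BE]].
have corner (u : 'cV[C]_(1 + n.+1)) M :
    (u *m u ^t* + block_mx 0 0 0 M) 0 0 = `|u 0 0| ^+ 2.
  rewrite [LHS]mxE outer_mxE -normCK.
  have -> : 0 = lshift n.+1 (0 : 'I_1) by exact: val_inj.
  by rewrite block_mxEul mxE addr0.
have det_congr (u : 'cV[C]_n.+2) (X : 'M[C]_n.+2) :
    \det (toeplitz u *m X *m (toeplitz u) ^t*) =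
    (`|u 0 0| ^+ 2) ^+ n.+2 * \det X.
  rewrite !det_mulmx det_map_mx det_tr det_toeplitz rmorphXn /= mulrAC.
  by rewrite -exprMn -normCK.
(* [A 0 0] is [|v 0 0| ^+ 2], so its power is the factor by which congruence with [toeplitz v]
   scales determinants. *)
have outerA : A 0 0 ^+ n.+2 * \det B = \det (jury_mul (v *m v ^t*) B).
  by rewrite jury_mulC jury_mul_outer det_congr AE corner.
have outerB : B 0 0 ^+ n.+2 * \det A = \det (jury_mul A (w *m w ^t*)).
  by rewrite jury_mul_outer det_congr BE corner.
(* [p] holds the coefficients of the truncated product of the polynomials of [w] and [v]. *)
rewrite outerA outerB; set p := toeplitz w *m v.
have pE : jury_mul (v *m v ^t*) (w *m w ^t*) = p *m p ^t*.
  by rewrite jury_mul_outer trmxC_mul !mulmxA.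
have [X XE] := jury_mul_block A' (w *m w ^t*).
have [Y YE] := jury_mul_block B' (v *m v ^t*).
have [Z ZE] := jury_mul_block A' (block_mx 0 0 0 B').
have psdA := @psd_block C 1 _ _ hA'; have psdB := @psd_block C 1 _ _ hB'.
have hX : psd X.
  by apply: (@psd_drblock _ 1); rewrite -XE; apply: psd_jury_mul (psd_outer w).
have hY : psd Y.
  by apply: (@psd_drblock _ 1); rewrite -YE; apply: psd_jury_mul (psd_outer v).
have hZ : psd Z.
  by apply: (@psd_drblock _ 1); rewrite -ZE; apply: psd_jury_mul.
rewrite AE BE !jury_mulDl !jury_mulDr.
rewrite [jury_mul (v *m _) (block_mx _ _ _ _)]jury_mulC XE YE ZE pE.
apply: le_trans (det_outer_superadditive p hX hY) _.
have -> : p *m p ^t* + block_mx 0 0 0 Y + (block_mx 0 0 0 X + block_mx 0 0 0 Z)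
    = p *m p ^t* + block_mx 0 0 0 (X + Y + Z).
  rewrite -addrA !add_block_mx !addr0; congr (_ + block_mx _ _ _ _).
  by rewrite addrA [Y + X]addrC.
(* A second use of superadditivity adds [Z]; the determinant it brings along is nonnegative. *)
apply: le_trans (det_outer_superadditive p (psdD hX hY) hZ).
by rewrite lerDl det_outerD mulr_ge0 ?exprn_ge0 ?psd_det_ge0.
Qed.

End JuryProduct.

Theorem theorem2p1 (R : realType) (N : nat) (hN : (2 <= N)%N)
    (A B : 'M[R[i]]_N) (hA : psd A) (hB : psd B) :
  \det (jury_mul A B) >=
    entry00 hN B ^+ N * \det A + entry00 hN A ^+ N * \det B.
Proof.
case: N hN A B hA hB => [|[|n]] hN A B hA hB //.
have := jury_mul_det hA hB; rewrite /entry00.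
by have -> : Ordinal (ltnW hN) = 0 by exact: val_inj.
Qed.
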